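(* Let $X$ be a finite cell complex of dimension $d$ and $0\le i\le d$, with $\operatorname{rk}\widetilde H_{i-1}(X)=0$ and $\operatorname{rk}\widetilde H_i(X)=1$. Let $\lambda=\sum_{U\in\mathcal U_i} w(C_U)\,C_U\in Z_i(X)$ be the $i$-th standard harmonic cycle, $w$ the $i$-winding number and $k_i(X)$ the $i$-tree number. Then for every $z\in Z_i(X)$, $$z\circ\lambda = w(z)\,k_i(X),$$ where $\circ$ is the standard inner product on $C_i(X)$ for which the $i$-cells are orthonormal.
   Context: Notation: $X_j$ is the finite set of $j$-cells of $X$ (in a fixed order), $C_j=C_j(X)$ is the free abelian group on $X_j$ for $0\le j\le d$, $C_{-1}=\mathbb Z$, other $C_j=0$; $\partial_j:C_j\to C_{j-1}$ is the integer cellular boundary matrix, with $\partial_0(x)=1$ for each vertex $x$ (augmented complex). $Z_j=\ker\partial_j$, $B_j=\operatorname{im}\partial_{j+1}$ (over $\mathbb Z$), $\widetilde H_j=Z_j/B_j$. $\mathcal S_i$ is the set of subcomplexes $Y$ with $X^{i-1}\subseteq Y\subseteq X^i$ ($X^j$ the $j$-skeleton); $Y$ is determined by its set $I(Y)\subseteq X_i$ of $i$-cells. For a $\mathbb Z$-basis $Z$ of $Z_{i-1}(X)$, $[\partial_i]_Z$ is the matrix of the columns of $\partial_i$ in the basis $Z$. An $i$-dimensional spanning tree is $T\in\mathcal S_i$ with $|I(T)|=\operatorname{rk}Z_{i-1}(X)$ and $\widetilde H_{i-1}(T)$ finite; its weight is $\mathrm{wt}(T)=|\widetilde H_{i-1}(T)|$.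 The $i$-tree number is $k_i(X)=\sum_T \mathrm{wt}(T)^2$ over all such $T$. An $i$-cycletree is $U\in\mathcal S_i$ with $|I(U)|=\operatorname{rk}Z_{i-1}(X)+1$; $\mathcal U_i$ is the set of all $i$-cycletrees. The cycle part $C_U\in Z_i(X)$: let $A$ be the $n\times(n+1)$ submatrix of $[\partial_i]_Z$ with columns indexed by $I(U)$, $n=\operatorname{rk}Z_{i-1}(X)$; the $j$-th entry of $C_U$ along $I(U)$ is $(-1)^j\det([A]_j)$, where $[A]_j$ is $A$ with its $j$-th column deleted; all entries outside $I(U)$ are $0$. Winding number: let $\overline\partial_{i+1}$ be a matrix whose columns form a $\mathbb Z$-basis of $B_i(X)$ (so it has $\operatorname{rk}Z_i(X)-1$ columns). For a fixed $\mathbb Z$-basis $Z'$ of $Z_i(X)$, $w:Z_i(X)\to\mathbb Z$ is $w(z)=\det([z]_{Z'},[\overline\partial_{i+1}]_{Z'})$, where $[\cdot]_{Z'}$ denotes coordinates in $Z'$. It is well defined up to a global sign; the same choice is used throughout. *)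

(* Defs.v *)
From mathcomp Require Import all_boot all_order all_algebra finmap.
From mathcomp Require Import boolp classical_sets functions cardinality.

Set Implicit Arguments.
Unset Strict Implicit.
Unset Printing Implicit Defensive.

Import GRing.Theory.
Local Open Scope classical_set_scope.
Local Open Scope ring_scope.

(* Subgroups L, B of Z^N, with B contained in L whenever L / B is meant. *)
Section Lattices.
Variable N : nat.
Implicit Types L B : set 'cV[int]_N.

Definition Zbasis L r (V : 'M[int]_(N, r)) : Prop :=
  (forall c : 'cV[int]_r, V *m c = 0 -> c = 0) /\
  L = range (fun c : 'cV[int]_r => V *m c).

Definition indep_mod L B k (V : 'M[int]_(N, k)) : Prop :=
  (forall j, L (col j V)) /\ (forall c : 'cV[int]_k, B (V *m c) -> c = 0).

(* The rank of the abelian group L / B: the largest size of a Z-linearly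
   independent family.  Such a family lifts to an independent family in Z^N,
   so that its size is at most N. *)
Definition rk_quot L B : nat :=
  \max_(k < N.+1 | `[< exists V : 'M[int]_(N, k), indep_mod L B V >]) k.

Definition rk L : nat := rk_quot L [set 0].

Definition quot L B : set (set 'cV[int]_N) :=
  [set [set v + b | b in B] | v in L].

(* The order of L / B when it is finite (and 0 otherwise). *)
Definition quot_order L B : nat := #|` fset_set (quot L B)|.

(* The coordinates [V]_Z of the columns of V in the basis Z of a subgroup
   that contains them; the equation has then exactly one solution. *)
Definition coords r (Z : 'M[int]_(N, r)) m (V : 'M[int]_(N, m)) :
  'M[int]_(r, m) := xget 0 [set D | Z *m D = V].

Definition inner (u v : 'cV[int]_N) : int := \sum_x u x 0 * v x 0.

End Lattices.

(* A finite cell complex, given by its numbers of cells and its cellular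
   boundary matrices: the j-cells, in their fixed order, are 'I_(ncells j), and
   bdS j is the matrix of d_(j+1).  The matrix of d_0 is the all-one row.
   Attaching maps are not recorded: only the cellular chain complex matters,
   and every finite cell complex gives rise to such data. *)
Record cellComplex := CellComplex {
  cdim : nat;
  ncells : nat -> nat;
  bdS : forall j, 'M[int]_(ncells j, ncells j.+1);
  ncells0_gt0 : (0 < ncells 0)%N;
  ncells_dim_gt0 : (0 < ncells cdim)%N;
  ncells_gt_dim : forall j, (cdim < j)%N -> ncells j = 0%N;
  aug_bdS : (const_mx 1 : 'M[int]_(1, ncells 0)) *m bdS 0 = 0;
  bdS_bdS : forall j, bdS j *m bdS j.+1 = 0
}.

Section Complex.
Variable X : cellComplex.

(* Degrees are shifted so as to start from -2: crank k is the rank of C_(k-2),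
   where C_(-2) = 0 and C_(-1) = Z, and bdry k : C_(k-1) -> C_(k-2) is the
   matrix of d_(k-1).  Thus d_i is bdry i.+1 : 'M_(crank i.+1, ncells X i). *)
Definition crank (k : nat) : nat :=
  match k with 0 => 0%N | 1 => 1%N | j.+2 => ncells X j end.

Definition bdry (k : nat) : 'M[int]_(crank k, crank k.+1) :=
  match k return 'M[int]_(crank k, crank k.+1) with
  | 0 => 0
  | 1 => const_mx 1
  | j.+2 => bdS X j
  end.

(* Same shift: cycles k, boundaries k and rk_homology k are Z_(k-1), B_(k-1)
   and the rank of the reduced homology in degree k-1. *)
Definition cycles (k : nat) : set 'cV[int]_(crank k.+1) :=
  [set z | bdry k *m z = 0].

Definition boundaries (k : nat) : set 'cV[int]_(crank k.+1) :=
  range (fun c : 'cV[int]_(crank k.+2) => bdry k.+1 *m c).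

Arguments cycles : clear implicits.
Arguments boundaries : clear implicits.

Definition rk_homology (k : nat) : nat := rk_quot (cycles k) (boundaries k).

Section Trees.
Variable i : nat.

(* The rank of Z_(i-1)(X). *)
Definition rkZ : nat := rk (cycles i).

(* A subcomplex Y between the (i-1)- and the i-skeleton is represented by its
   set IY of i-cells.  It has the same (i-1)-cycles as X, and its
   (i-1)-boundaries are the images of the i-chains supported on IY. *)
Definition sub_boundaries (IY : {set 'I_(ncells X i)}) :
    set 'cV[int]_(crank i.+1) :=
  [set bdry i.+1 *m c | c in
    [set c : 'cV[int]_(ncells X i) | forall x, x \notin IY -> c x 0 = 0]].

Definition spanning_tree (IT : {set 'I_(ncells X i)}) : Prop :=
  #|IT| = rkZ /\ finite_set (quot (cycles i) (sub_boundaries IT)).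

Definition weight (IT : {set 'I_(ncells X i)}) : nat :=
  quot_order (cycles i) (sub_boundaries IT).

Definition tree_number : nat :=
  (\sum_(IT : {set 'I_(ncells X i)} | `[< spanning_tree IT >]) weight IT ^ 2)%N.

Definition cycletree := {IU : {set 'I_(ncells X i)} | #|IU| == rkZ.+1}.

(* The i-cells of U, listed in increasing order. *)
Definition cell_of (U : cycletree) (j : 'I_rkZ.+1) : 'I_(ncells X i) :=
  enum_val (cast_ord (esym (eqP (valP U))) j).

Definition cycletree_mx (Z : 'M[int]_(crank i.+1, rkZ)) (U : cycletree) :
    'M[int]_(rkZ, rkZ.+1) :=
  colsub (cell_of U) (coords Z (bdry i.+1)).

(* Columns are numbered from 1, whence the exponent j.+1; the sum has a single
   term when x belongs to U and is empty otherwise. *)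
Definition cycle_part (Z : 'M[int]_(crank i.+1, rkZ)) (U : cycletree) :
    'cV[int]_(ncells X i) :=
  \col_x \sum_(j | cell_of U j == x)
    (-1) ^+ j.+1 * \det (col' j (cycletree_mx Z U)).

(* Zi and Bi are meant to be bases of Z_i(X) and B_i(X); their numbers of
   columns differ by one when the i-th homology group has rank 1. *)
Definition winding b (Zi : 'M[int]_(ncells X i, 1 + b))
    (Bi : 'M[int]_(ncells X i, b)) (z : 'cV[int]_(ncells X i)) : int :=
  \det (row_mx (coords Zi z) (coords Zi Bi) : 'M[int]_(1 + b)).

Definition std_harmonic_cycle (Z : 'M[int]_(crank i.+1, rkZ))
    b (Zi : 'M[int]_(ncells X i, 1 + b)) (Bi : 'M[int]_(ncells X i, b)) :
    'cV[int]_(ncells X i) :=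
  \sum_(U : cycletree) winding Zi Bi (cycle_part Z U) *: cycle_part Z U.

End Trees.
End Complex.

Arguments cycles : clear implicits.
Arguments boundaries : clear implicits.
Arguments bdry : clear implicits.

(* Main.v *)
Require Import Defs.
From mathcomp Require Import all_boot all_order all_fingroup all_algebra finmap.
From mathcomp Require Import boolp classical_sets functions cardinality.

(** Write D for the matrix of the boundary map d_i, and factor it as
    D = Z *m A through the basis Z of Z_(i-1)(X), so that A is the n x N matrix
    of coordinates, n = rk Z_(i-1)(X).  Both sides are computed by the
    Cauchy-Binet formula ([Cauchy_Binet]), applied on the left to copies of A
    bordered by an extra row, and on the right to A itself.

    Expanding along the first row, v o C_U is, up to a global sign, the maximal
    minor with columns U of A bordered by the row v on top
    ([inner_cycle_part]).  In particular A C_U = 0, since bordering A with one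
    of its own rows gives vanishing minors, so that C_U is a cycle.  For a cycle
    z and a cell x, with indicator chain e_x, the sum over U of
    (z o C_U) (e_x o C_U) is thus a sum of products of maximal minors, that is,
    the determinant of the product of A bordered by e_x and the transpose of A
    bordered by z.  As A z = 0 this product is block triangular, with diagonal
    blocks z x and A A^T.  Letting x vary gives [sum_inner_cycle_part]:
      sum_U (z o C_U) C_U = det (A A^T) z.

    On the other hand, the Smith normal form shows that a nonsingular square
    integer matrix M has a cokernel of order |det M|, and that the cokernel is
    infinite when det M = 0 ([quot_order_det]).  Hence the weight of a set S of
    n cells is the absolute value of the minor of A on S, with the value 0
    exactly when S is not a spanning tree, and Cauchy-Binet for A A^T reads
    k_i(X) = det (A A^T) ([tree_number_det]).

    The winding number is linear on cycles ([winding_sum]), so that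
      z o lambda = sum_U w(C_U) (z o C_U) = w(sum_U (z o C_U) C_U)
                 = w(k_i(X) z) = w(z) k_i(X). *)

Set Implicit Arguments.
Unset Strict Implicit.
Unset Printing Implicit Defensive.

Import Order.TTheory GRing.Theory Num.Theory.
Local Open Scope classical_set_scope.
Local Open Scope ring_scope.

(** * The Cauchy-Binet formula *)

Section CauchyBinet.

Variable R : comNzRingType.

Lemma det_colsub_perm m N (e : 'I_m -> 'I_N) (B : 'M[R]_(m, N)) (s : 'S_m) :
  \det (colsub (e \o s) B) = (-1) ^+ s * \det (colsub e B).
Proof.
rewrite colsub_comp -col_permEsub -[s]invgK col_permE det_mulmx det_perm.
by rewrite odd_permV mulrC.
Qed.

Lemma det_colsub_noninj m N (f : {ffun 'I_m -> 'I_N}) (B : 'M[R]_(m, N)) :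
  ~~ injectiveb f -> \det (colsub f B) = 0.
Proof.
case/injectivePn => j1 [j2 Dj12 Ef12].
rewrite -det_tr; apply: (determinant_alternate Dj12) => k.
by rewrite !mxE Ef12.
Qed.

(** Multilinearity of the determinant in the rows of the product, before any
    cancellation or regrouping of the column choices f. *)
Lemma det_mul_tr_expand m N (A B : 'M[R]_(m, N)) :
  \det (A *m B^T)
  = \sum_(f : {ffun 'I_m -> 'I_N}) \prod_i A i (f i) * \det (colsub f B).
Proof.
pose AB (s : 'S_m) i x := A i x * B (s i) x.
transitivity (\sum_(f : {ffun 'I_m -> 'I_N}) \sum_(s : 'S_m)
                (-1) ^+ s * \prod_i AB s i (f i)).
  rewrite exchange_big; apply: eq_bigr => /= s _; rewrite -big_distrr /=.
  congr (_ * _); rewrite -(bigA_distr_bigA (AB s)) /=.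
  by apply: eq_bigr => i _; rewrite mxE; apply: eq_bigr => x _; rewrite mxE.
apply: eq_bigr => f _; rewrite -det_tr big_distrr /=.
apply: eq_bigr => s _; rewrite mulrCA big_split //=; congr (_ * (_ * _)).
by apply: eq_bigr => i _; rewrite !mxE.
Qed.

(** The injections of image S are the rearrangements of any one of them: this
    groups the terms of the expansion of a determinant by sets of columns. *)
Lemma sum_injections_onto m (T : finType) (e : 'I_m -> T) (S : {set T})
    (F : {ffun 'I_m -> T} -> R) :
    injective e -> e @: 'I_m = S ->
  \sum_(f : {ffun 'I_m -> T} | injectiveb f && (f @: 'I_m == S)) F f
  = \sum_(s : 'S_m) F [ffun j => e (s j)].
Proof.
move=> inj_e imS.
rewrite (reindex (fun s : 'S_m => [ffun j => e (s j)])) /=.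
  apply: eq_bigl => s; apply/andP; split.
    by apply/injectiveP => j k; rewrite !ffunE => /inj_e /perm_inj.
  rewrite eqEcard -imS card_imset // card_imset ?leqnn ?andbT.
    by apply/fintype.subsetP => _ /imsetP[j _ ->]; rewrite ffunE imset_f.
  by move=> j k; rewrite !ffunE => /inj_e /perm_inj.
(* The inverse reads f in the numbering e; the default values of odflt and of
   insubd never occur for an injection f of image S. *)
pose back (f : {ffun 'I_m -> T}) := [ffun j => odflt j [pick k | e k == f j]].
exists (fun f => insubd (1%g : 'S_m) (back f)) => [s _ | f].
  apply: val_inj; rewrite val_insubd.
  have -> : back [ffun j => e (s j)] = pval s.
    apply/ffunP=> j; rewrite !ffunE pvalE.
    case: pickP => [k /eqP/inj_e -> // | /(_ (s j))].
    by rewrite eqxx.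
  by rewrite (valP s).
case/andP => /injectiveP inj_f /eqP imf.
have backK j : e (back f j) = f j.
  rewrite ffunE; case: pickP => [k /eqP // | noK].
  have : f j \in e @: 'I_m by rewrite imS -imf imset_f.
  by case/imsetP => k _ fj; have := noK k; rewrite fj eqxx.
have inj_back : injectiveb (back f).
  by apply/injectiveP => j k eq_jk; apply: inj_f; rewrite -!backK eq_jk.
by apply/ffunP=> j; rewrite ffunE -pvalE val_insubd inj_back backK.
Qed.

(** The cells of a cycletree are numbered by this function, up to conversion. *)
Definition subset_enum m N (S : {set 'I_N}) (cardS : #|S| == m) (j : 'I_m) :
    'I_N := enum_val (cast_ord (esym (eqP cardS)) j).

Lemma subset_enum_inj m N (S : {set 'I_N}) (cardS : #|S| == m) :
  injective (subset_enum cardS).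
Proof. by move=> j k /enum_val_inj/cast_ord_inj. Qed.

Lemma imset_subset_enum m N (S : {set 'I_N}) (cardS : #|S| == m) :
  subset_enum cardS @: 'I_m = S.
Proof.
apply/eqP; rewrite eqEcard (card_imset _ (subset_enum_inj (cardS := cardS))).
rewrite card_ord (eqP cardS) leqnn andbT.
by apply/fintype.subsetP => _ /imsetP[j _ ->]; apply: enum_valP.
Qed.

Lemma Cauchy_Binet m N (A B : 'M[R]_(m, N)) :
  \det (A *m B^T)
  = \sum_(S : {S : {set 'I_N} | #|S| == m})
      \det (colsub (subset_enum (valP S)) A)
        * \det (colsub (subset_enum (valP S)) B).
Proof.
rewrite det_mul_tr_expand
  (bigID (fun f : {ffun 'I_m -> 'I_N} => injectiveb f)) /= addrC.
rewrite big1 ?add0r => [|f /det_colsub_noninj ->]; last by rewrite mulr0.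
rewrite (partition_big (fun f : {ffun 'I_m -> 'I_N} => f @: 'I_m)
           (fun S => #|S| == m)) /=; last first.
  by move=> f /injectiveP /card_imset ->; rewrite card_ord.
etransitivity; first exact: (big_sub [pred S : {set 'I_N} | #|S| == m]).
apply: eq_bigr => S _.
rewrite (sum_injections_onto _ (@subset_enum_inj _ _ _ (valP S))
           (imset_subset_enum _)).
rewrite [in RHS]/(\det (colsub _ A)) big_distrl /=; apply: eq_bigr => s _.
have -> : colsub [ffun j => subset_enum (valP S) (s j)] B
          = colsub (subset_enum (valP S) \o s) B.
  by apply: eq_colsub => j; rewrite ffunE.
rewrite det_colsub_perm mulrCA mulrA; congr (_ * _ * _).
by apply: eq_bigr => i _; rewrite !mxE ffunE.
Qed.

End CauchyBinet.

(** * The index of a sublattice *)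

Lemma coset_eqP N m (P : 'M[int]_(N, m)) (B : set 'cV[int]_N)
    (v v' : 'cV[int]_N) :
    B = range (fun c : 'cV[int]_m => P *m c) ->
  [set v + b | b in B] = [set v' + b | b in B] <-> B (v - v').
Proof.
move=> ->; split=> [eq_vv' | [c _ Pc]].
  have : [set v + b | b in range (fun c : 'cV[int]_m => P *m c)] v.
    by exists 0; rewrite ?addr0 //; exists 0; rewrite ?mulmx0.
  rewrite eq_vv' => -[_ [c _ <-] <-].
  by rewrite addrC addKr; exists c.
have -> : v = v' + P *m c by rewrite Pc addrC subrK.
apply/seteqP; split=> _ [_ [c' _ <-] <-].
  by exists (P *m (c + c')); [exists (c + c') | rewrite mulmxDr addrA].
exists (P *m (c' - c)); first by exists (c' - c).
by rewrite -addrA -mulmxDr [c + _]addrC subrK.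
Qed.

Lemma absz_det_unit n (M : 'M[int]_n) : M \in unitmx -> `|\det M|%N = 1%N.
Proof.
move=> uM; have := congr1 absz (congr1 determinant (mulmxV uM)).
rewrite det_mulmx det1 abszM => /eqP; rewrite muln_eq1.
by case/andP=> /eqP.
Qed.

Lemma card_fset_set_infinite (U : choiceType) (A : set U) :
  infinite_set A -> #|` fset_set A| = 0%N.
Proof. by rewrite /fset_set; case: pselect => // _ _; rewrite cardfs0. Qed.

Lemma card_fset_set_range (T : finType) (U : choiceType) (f : T -> U) :
  injective f -> #|` fset_set (range f)| = #|T|.
Proof.
move=> inj_f; have uf : uniq (map f (enum T)).
  by rewrite map_inj_uniq ?enum_uniq.
have -> : range f = [set` [fset x in map f (enum T)]%fset].
  apply/seteqP; split=> x /=; rewrite !inE.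
    by case=> t _ <-; rewrite map_f // mem_enum.
  by case/mapP=> t _ ->; exists t.
by rewrite set_fsetK card_fseq undup_id // size_map -cardE.
Qed.

Section CardMod.

Variables (r : nat) (d : seq int) (U : choiceType) (K : 'cV[int]_r -> U).
Hypothesis KP : forall t t',
  K t = K t' <-> forall i : 'I_r, (d`_i %| (t i 0 - t' i 0)%R)%Z.

(** The range of K is in bijection with the product of the groups Z / d_i.  When
    some d_i is 0 it is infinite, and the equality still holds because [fset_set]
    sends an infinite set to the empty one. *)
Lemma card_range_mod :
  #|` fset_set (range K)| = (\prod_(i < r) `|(d`_i)%R|)%N.
Proof.
have [/forallP d_neq0 | ] := boolP [forall i : 'I_r, d`_i != 0]; last first.
  rewrite negb_forall => /existsP[i0]; rewrite negbK => /eqP di0.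
  rewrite [RHS](bigD1 i0) //= di0 mul0n.
  rewrite card_fset_set_infinite //; apply/infiniteP.
  pose f (k : nat) := K (k%:Z *: delta_mx i0 0).
  have -> : [set: nat] = f @^-1` range K.
    by apply/seteqP; split=> // k _; exists (k%:Z *: delta_mx i0 0).
  apply: card_ge_preimage => k l _ _ /KP/(_ i0).
  by rewrite di0 dvd0z !mxE !eqxx !mulr1 subr_eq0 => /eqP[].
(* The values of K are those on the vectors with 0 <= t_i < |d_i|. *)
pose T := {dffun forall i : 'I_r, 'I_(`|(d`_i)%R|)}.
pose g (u : T) := K (\col_i (u i : nat)%:Z).
have inj_g : injective g.
  move=> u u' /KP eq_uu'; apply/ffunP=> i; apply/val_inj.
  have := eq_uu' i; rewrite !mxE -eqz_mod_dvd -!(modz_abs _ d`_i).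
  rewrite !modz_small; first by move/eqP=> [].
    by rewrite le0z_nat ltz_nat ltn_ord.
  by rewrite le0z_nat ltz_nat ltn_ord.
have -> : range K = range g.
  apply/seteqP; split=> _ [t _ <-]; last by exists (\col_i (t i : nat)%:Z).
  have ltd i : (`|((t i 0)%R %% d`_i)%Z| < `|(d`_i)%R|)%N.
    by rewrite -ltz_nat gez0_abs ?modz_ge0 ?ltz_mod // abszE.
  exists [ffun i => Ordinal (ltd i)] => //; apply/KP => i.
  rewrite mxE ffunE /= gez0_abs ?modz_ge0 // -eqz_mod_dvd.
  by rewrite modz_mod.
rewrite card_fset_set_range // card_dep_ffun foldrE big_image /=.
by apply: eq_bigr => i _; rewrite card_ord.
Qed.

End CardMod.

(** Row and column operations on M change neither the quotient nor the absolute
    value of the determinant, and reduce M to a diagonal matrix. *)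
Lemma quot_order_det N r (Z : 'M[int]_(N, r)) (M : 'M[int]_r)
    (L B : set 'cV[int]_N) :
    Zbasis L Z -> B = range (fun c : 'cV[int]_r => Z *m M *m c) ->
  quot_order L B = `|\det M|%N.
Proof.
case=> inj_Z defL defB.
case: (int_Smith_normal_form M) => S uS [R uR [d _ defM]].
pose D := \matrix_(i < r, j < r) (d`_i *+ (i == j :> nat)).
pose K (t : 'cV[int]_r) := [set Z *m (S *m t) + b | b in B].
have -> : quot_order L B = #|` fset_set (range K)|.
  congr #|` fset_set _|; apply/seteqP; split=> x /=.
    rewrite /quot defL => -[_ [c _ <-] <-]; exists (invmx S *m c) => //.
    by rewrite /K mulKVmx.
  by case=> t _ <-; exists (Z *m (S *m t)) => //; rewrite defL; exists (S *m t).
have DE (c : 'cV[int]_r) i : (D *m c) i 0 = d`_i * c i 0.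
  rewrite mxE (bigD1 i) //= big1 => [|j Dij]; first by rewrite mxE eqxx addr0.
  by rewrite mxE eq_sym (inj_eq val_inj) (negPf Dij) mul0r.
rewrite (@card_range_mod r d) => [|t t']; last first.
  apply: (iff_trans (coset_eqP _ _ defB)); rewrite -!mulmxBr defB; split.
    case=> c _ /eqP; rewrite -mulmxA -subr_eq0 -mulmxBr => /eqP/inj_Z/eqP.
    rewrite subr_eq0 defM -!mulmxA => /eqP/(can_inj (mulKmx uS)) eq_t i.
    have := congr1 (fun w : 'cV[int]_r => w i 0) eq_t.
    by rewrite DE !mxE => <-; rewrite dvdz_mulr.
  move=> dvd_t; pose q := \col_i ((t i 0 - t' i 0)%R %/ d`_i)%Z.
  exists (invmx R *m q) => //; rewrite defM -!mulmxA mulKVmx //.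
  do 2!congr (_ *m _); apply/colP=> i.
  by rewrite DE !mxE mulrC divzK.
rewrite defM !det_mulmx !abszM (absz_det_unit uS) (absz_det_unit uR).
have -> : \matrix_(i < r, j < r) (d`_i *+ (i == j :> nat))
          = diag_mx (\row_i d`_i).
  by apply/matrixP=> i j; rewrite !mxE.
rewrite det_diag mul1n muln1 (big_morph absz abszM absz1).
by apply: eq_bigr => i _; rewrite mxE.
Qed.

(** * Coordinates in a basis of a lattice *)

Lemma coordsK N r (L : set 'cV[int]_N) (Z : 'M[int]_(N, r)) m
    (V : 'M[int]_(N, m)) :
  Zbasis L Z -> (forall j, L (col j V)) -> Z *m coords Z V = V.
Proof.
case=> _ defL LV; rewrite /coords.
apply: (@xgetPex _ 0 [set D | Z *m D = V]).
have cV j : exists c : 'cV[int]_r, Z *m c = col j V.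
  by have := LV j; rewrite defL => -[c _ <-]; exists c.
have [c cE] := choice cV; exists (\matrix_(k, j) c j k 0).
apply/matrixP=> x j; transitivity (col j V x 0); last by rewrite mxE.
by rewrite -cE !mxE; apply: eq_bigr => k _; rewrite mxE.
Qed.

Lemma coords_cVK N r (L : set 'cV[int]_N) (Z : 'M[int]_(N, r))
    (v : 'cV[int]_N) :
  Zbasis L Z -> L v -> Z *m coords Z v = v.
Proof.
by move=> bZ Lv; apply: (coordsK bZ) => j; rewrite [j]ord1 col_id.
Qed.

Lemma coords_sum N r (L : set 'cV[int]_N) (Z : 'M[int]_(N, r)) (I : finType)
    (a : I -> int) (v : I -> 'cV[int]_N) :
    Zbasis L Z -> (forall i, L (v i)) ->
  coords Z (\sum_i a i *: v i) = \sum_i a i *: coords Z (v i).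
Proof.
move=> bZ Lv; have [inj_Z defL] := bZ.
have Z_sum : Z *m (\sum_i a i *: coords Z (v i)) = \sum_i a i *: v i.
  rewrite mulmx_sumr; apply: eq_bigr => i _.
  by rewrite -scalemxAr (coords_cVK bZ).
have Lsum : L (\sum_i a i *: v i).
  by rewrite defL; exists (\sum_i a i *: coords Z (v i)).
apply/eqP; rewrite -subr_eq0; apply/eqP/inj_Z.
by rewrite mulmxBr Z_sum (coords_cVK bZ) // subrr.
Qed.

Lemma det_row_mx_sum b (I : finType) (a : I -> int) (c : I -> 'cV[int]_(1 + b))
    (M : 'M[int]_(1 + b, b)) :
  \det (row_mx (\sum_i a i *: c i) M : 'M_(1 + b))
  = \sum_i a i * \det (row_mx (c i) M : 'M_(1 + b)).
Proof.
(* The cofactors along the first column do not depend on that column. *)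
pose gamma k :=
  cofactor (row_mx (0 : 'cV_(1 + b)) M : 'M_(1 + b)) k (lshift b 0).
have detE (v : 'cV[int]_(1 + b)) :
    \det (row_mx v M : 'M_(1 + b)) = \sum_k v k 0 * gamma k.
  rewrite (expand_det_col _ (lshift b 0)); apply: eq_bigr => k _.
  rewrite row_mxEl /gamma /cofactor; congr (_ * (_ * \det _)).
  apply/matrixP=> p q; rewrite !mxE; case: splitP => // s.
  by rewrite [s]ord1.
rewrite detE; under [RHS]eq_bigr do rewrite detE big_distrr /=.
rewrite exchange_big; apply: eq_bigr => k _ /=.
rewrite summxE big_distrl; apply: eq_bigr => i _ /=.
by rewrite mxE mulrA.
Qed.

Lemma inner_sumr N (I : finType) (z : 'cV[int]_N) (a : I -> int)
    (v : I -> 'cV[int]_N) :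
  inner z (\sum_i a i *: v i) = \sum_i a i * inner z (v i).
Proof.
rewrite /inner; under eq_bigr do rewrite summxE big_distrr /=.
rewrite exchange_big; apply: eq_bigr => k _ /=; rewrite big_distrr /=.
by apply: eq_bigr => x _; rewrite mxE mulrCA.
Qed.

(** * Cycle parts, weights and the tree number *)

Section Complex.

Variables (X : cellComplex) (i : nat).

Lemma bdry_bdry : bdry X i *m bdry X i.+1 = 0.
Proof.
case: i => [|[|j]]; [exact: flatmx0 | exact: aug_bdS | exact: bdS_bdS].
Qed.

Lemma winding_sum b (Zi : 'M[int]_(ncells X i, 1 + b))
    (Bi : 'M[int]_(ncells X i, b)) (I : finType)
    (a : I -> int) (v : I -> 'cV[int]_(ncells X i)) :
    Zbasis (cycles X i.+1) Zi -> (forall k, cycles X i.+1 (v k)) ->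
  winding Zi Bi (\sum_k a k *: v k) = \sum_k a k * winding Zi Bi (v k).
Proof.
by move=> bZi cv; rewrite /winding (coords_sum _ bZi) // det_row_mx_sum.
Qed.

Section CycleParts.

Variable Z : 'M[int]_(crank X i.+1, rkZ X i).
Hypothesis Z_basis : Zbasis (cycles X i) Z.

Let A : 'M[int]_(rkZ X i, ncells X i) := coords Z (bdry X i.+1).

Lemma bdry_coords : bdry X i.+1 = Z *m A.
Proof.
rewrite (coordsK Z_basis) // => j; rewrite /cycles /=.
by rewrite colE mulmxA bdry_bdry mul0mx.
Qed.

Lemma cycles_coords (z : 'cV[int]_(ncells X i)) : cycles X i.+1 z -> A *m z = 0.
Proof.
(* Locked, the boundary matrix is not reduced to a case analysis on i. *)
rewrite /cycles [bdry]lock /= -lock bdry_coords -mulmxA.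
by case: Z_basis => inj_Z _; apply: inj_Z.
Qed.

(** Laplace expansion along the bordering row v: the minors of the cycle part
    are those obtained by deleting this row and a column.  Numbering the columns
    from 1 reverses every sign of that expansion. *)
Lemma inner_cycle_part (U : cycletree X i) (v : 'cV[int]_(ncells X i)) :
  inner v (cycle_part Z U)
  = - \det (colsub (subset_enum (valP U)) (col_mx v^T A)
            : 'M_((rkZ X i).+1)).
Proof.
rewrite (expand_det_row _ ord0) -sumrN /inner.
under eq_bigr do rewrite mxE big_distrr /=.
rewrite (exchange_big_dep predT) //=; apply: eq_bigr => j _.
rewrite (big_pred1 (cell_of U j)) => [|x]; last by rewrite eq_sym.
rewrite exprS mulN1r mulNr mulrN; congr (- _).
have -> : ord0 = lshift (rkZ X i) (0 : 'I_1) by apply: val_inj.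
rewrite mxE col_mxEu mxE.
congr (_ * (_ * \det _)).
apply/matrixP=> p q; rewrite !mxE.
have -> : lift (lshift (rkZ X i) (0 : 'I_1) : 'I_((rkZ X i).+1)) p
          = rshift 1 p.
  exact: val_inj.
have := col_mxEd v^T A p (subset_enum (valP U) (lift j q)).
by rewrite mxE => ->.
Qed.

Lemma cycle_part_cycle (U : cycletree X i) : cycles X i.+1 (cycle_part Z U).
Proof.
rewrite /cycles [bdry]lock /= -lock bdry_coords -mulmxA.
suff -> : A *m cycle_part Z U = 0 by rewrite mulmx0.
apply/colP=> k; rewrite [RHS]mxE.
transitivity (inner (row k A)^T (cycle_part Z U)).
  by rewrite mxE; apply: eq_bigr => x _; rewrite !mxE.
rewrite inner_cycle_part trmxK.
(* Row k of A appears both as the border and as row k. *)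
rewrite (determinant_alternate (i1 := lshift _ 0) (i2 := rshift 1 k)) ?oppr0 //.
by move=> j; rewrite mxE [RHS]mxE col_mxEu col_mxEd mxE.
Qed.

(** Entry x of the left-hand side is the Cauchy-Binet sum for two bordered
    copies of A, one by z and one by the indicator chain e of x. *)
Lemma sum_inner_cycle_part (z : 'cV[int]_(ncells X i)) : cycles X i.+1 z ->
  \sum_(U : cycletree X i) inner z (cycle_part Z U) *: cycle_part Z U
  = \det (A *m A^T) *: z.
Proof.
move=> cz; apply/colP=> x; rewrite summxE [RHS]mxE.
pose e : 'cV[int]_(ncells X i) := delta_mx x 0.
have inner_e v : inner e v = v x 0.
  rewrite /inner (bigD1 x) //= big1 => [|y Dxy]; last first.
    by rewrite mxE (negPf Dxy) mul0r.
  by rewrite mxE !eqxx mul1r addr0.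
transitivity (\det (col_mx e^T A *m (col_mx z^T A)^T)).
  rewrite Cauchy_Binet; apply: eq_bigr => U _.
  by rewrite mxE -[cycle_part Z U x 0]inner_e !inner_cycle_part mulrNN mulrC.
(* The block A z below the diagonal vanishes. *)
rewrite tr_col_mx trmxK mul_col_row (cycles_coords cz) det_ublock mulrC.
congr (_ * _); rewrite det_mx11 mxE -inner_e /inner.
by apply: eq_bigr => y _; rewrite mxE.
Qed.

Lemma sub_boundariesE (S : {set 'I_(ncells X i)}) (cardS : #|S| == rkZ X i) :
  sub_boundaries S
  = range (fun c : 'cV[int]_(rkZ X i) =>
             Z *m colsub (subset_enum cardS) A *m c).
Proof.
set s := subset_enum cardS.
have sS j : s j \in S by apply: enum_valP.
have E : Z *m colsub s A = bdry X i.+1 *m colsub s 1%:M.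
  by rewrite !mulmx_colsub mulmx1 bdry_coords.
rewrite E /sub_boundaries; apply/seteqP; split=> _ [c cP <-].
  exists (rowsub s c) => //; rewrite -mulmxA; congr (_ *m _).
  apply/colP=> x; have [xS | xNS] := boolP (x \in S); last first.
    rewrite (cP x xNS) mxE big1 // => j _; rewrite !mxE; case: eqP => [xE | _].
      by rewrite xE sS in xNS.
    by rewrite mul0r.
  have : x \in s @: 'I_(rkZ X i) by rewrite imset_subset_enum.
  case/imsetP=> j _ ->.
  rewrite mxE (bigD1 j) //= big1 => [|k Dkj]; rewrite !mxE.
    by rewrite eqxx mul1r addr0.
  by rewrite (inj_eq (@subset_enum_inj _ _ _ cardS)) eq_sym (negPf Dkj) mul0r.
exists (colsub s 1%:M *m c); last by rewrite mulmxA.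
move=> x xNS; rewrite mxE big1 // => j _; rewrite !mxE.
case: eqP => [Dx | _]; last by rewrite mul0r.
by rewrite Dx sS in xNS.
Qed.

Lemma weight_det (S : {set 'I_(ncells X i)}) (cardS : #|S| == rkZ X i) :
  weight S = `|\det (colsub (subset_enum cardS) A)|%N.
Proof.
exact: (quot_order_det Z_basis (sub_boundariesE cardS)).
Qed.

(** Every set of rk Z_(i-1)(X) cells may be allowed in the sum that defines the
    tree number: if it is not a spanning tree, its quotient is infinite, and the
    order of that quotient is then 0 by convention, like the minor. *)
Lemma tree_number_det : (tree_number X i)%:Z = \det (A *m A^T).
Proof.
rewrite Cauchy_Binet.
transitivity ((\sum_(S : {set 'I_(ncells X i)} | #|S| == rkZ X i)
                  weight S ^ 2)%N%:Z).
  congr Posz; rewrite /tree_number.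
  rewrite [RHS](bigID (fun S => `[< spanning_tree S >])) /=.
  rewrite [X in (_ + X)%N]big1 ?addn0 => [|S /andP[/eqP cS /asboolPn notT]].
    apply: eq_bigl => S; apply/asboolP/andP => [tS|[_ /asboolP]] //.
    by split; [apply/eqP; case: tS | apply/asboolP].
  rewrite /weight /quot_order card_fset_set_infinite // => fin.
  by apply: notT; split.
rewrite -natz natr_sum.
etransitivity.
  exact: (big_sub [pred S : {set 'I_(ncells X i)} | #|S| == rkZ X i]).
apply: eq_bigr => S _.
rewrite natz (weight_det (valP S)) -abszX abszE normrX.
by rewrite real_normK ?num_real // expr2.
Qed.

End CycleParts.

End Complex.

Theorem theorem5p0p1 (X : cellComplex) (i : nat)
    (i_le_dim : (i <= cdim X)%N)
    (rkH_prev : rk_homology X i = 0%N)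
    (rkH : rk_homology X i.+1 = 1%N)
    (Z : 'M[int]_(crank X i.+1, rkZ X i))
    (Z_basis : Zbasis (cycles X i) Z)
    (b : nat)
    (Zi : 'M[int]_(ncells X i, 1 + b))
    (Zi_basis : Zbasis (cycles X i.+1) Zi)
    (Bi : 'M[int]_(ncells X i, b))
    (Bi_basis : Zbasis (boundaries X i.+1) Bi)
    (z : 'cV[int]_(ncells X i))
    (z_cycle : cycles X i.+1 z) :
  inner z (std_harmonic_cycle Z Zi Bi)
    = winding Zi Bi z * (tree_number X i)%:Z.
Proof.
rewrite (tree_number_det Z_basis) /std_harmonic_cycle inner_sumr mulrC.
under eq_bigr do rewrite mulrC.
rewrite -(winding_sum _ _ Zi_basis) => [|U]; last exact: cycle_part_cycle.
rewrite (sum_inner_cycle_part Z_basis z_cycle).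
(* Homogeneity of the winding number, as a sum with a single term. *)
set k := \det _; have := winding_sum Bi (fun=> k) Zi_basis
                           (fun _ : 'I_1 => z_cycle).
by rewrite !big_ord1.
Qed.
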